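(* Let $(X_t)_{t\ge0}$ be a one-dimensional Lévy process with characteristic exponent $\psi$ and Lévy triplet $(b,Q,\nu)$, and let $\beta\in\mathbb{R}\setminus\{0\}$ be fixed. The following assertions are equivalent: (a) $\psi(\beta)=i\alpha$ for some $\alpha\in\mathbb{R}$; (b) $\left|\mathbb{E}\left[e^{i\beta X_t}\right]\right|=1$ for some, hence for all, $t>0$; (c) $X_{t_0}+\gamma$ has (almost surely) values in the lattice $2\pi\beta^{-1}\mathbb{Z}$ for some $t_0>0$ and some $\gamma\in\mathbb{R}$; (d) there is some $\alpha\in\mathbb{R}$ such that for all $t>0$ the random variable $X_t+\alpha\beta^{-1}t$ has (almost surely) values in the lattice $2\pi\beta^{-1}\mathbb{Z}$; (e) $\operatorname{supp}\nu\subset 2\pi\beta^{-1}\mathbb{Z}$, $Q=0$, and for some $\alpha\in\mathbb{R}$ $$b=-\alpha\beta^{-1}+2\pi\beta^{-1}\sum_{|k|<|\beta|/(2\pi)}k\,\nu(\{2\pi\beta^{-1}k\}),$$ the sum being over nonzero integers $k$. Here $\alpha$ is the same number in (a), (d) and (e): if one of these assertions holds with a given $\alpha$, then so do the other two with this $\alpha$.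
   Context: A one-dimensional Lévy process is a real-valued process with $X_0=0$, stationary and independent increments, and càdlàg paths. Its characteristic exponent $\psi$ is defined by $\mathbb{E}[e^{i\xi X_t}]=e^{-t\psi(\xi)}$ and has the form $$\psi(\xi)=-ib\xi+\tfrac12Q\xi^2+\int_{\mathbb{R}\setminus\{0\}}\left(1-e^{i\xi x}+i\xi x\,\mathbf{1}_{(0,1)}(|x|)\right)\nu(dx),\quad \xi\in\mathbb{R},$$ with Lévy triplet $(b,Q,\nu)$: $b\in\mathbb{R}$, $Q\ge0$, and $\nu$ a Radon measure on $\mathbb{R}\setminus\{0\}$ with $\int\min\{x^2,1\}\,\nu(dx)<\infty$. *)

(* Defs.v *)
From HB Require Import structures.
From mathcomp Require Import all_boot all_order all_algebra.
From mathcomp Require Import all_classical all_reals all_analysis.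
From mathcomp Require Export complex.
Import Order.TTheory GRing.Theory Num.Theory.
Import numFieldNormedType.Exports.

Set Implicit Arguments.
Unset Strict Implicit.
Unset Printing Implicit Defensive.

Local Open Scope classical_set_scope.
Local Open Scope ring_scope.
Local Open Scope complex_scope.

Definition cexp (R : realType) (z : R[i]) : R[i] :=
  (expR (complex.Re z))%:C * (cos (complex.Im z) +i* sin (complex.Im z)).

(* Used only when [f] is integrable over [D], i.e. its real and imaginary
   parts are. *)
Definition Cintegral d (T : measurableType d) (R : realType)
    (mu : {measure set T -> \bar R}) (D : set T) (f : T -> R[i]) : R[i] :=
  (\int[mu]_(x in D) complex.Re (f x)) +i* (\int[mu]_(x in D) complex.Im (f x)).

Definition Cexpectation d (T : measurableType d) (R : realType)
    (P : probability T R) (Z : T -> R[i]) : R[i] := Cintegral P setT Z.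

(* The product rule is only required for the whole family: taking some of the
   [B i] to be [setT] gives it for every subfamily. *)
Definition mutually_independent d (T : measurableType d) (R : realType)
    (P : probability T R) (n : nat) (Y : 'I_n -> T -> R) : Prop :=
  forall B : 'I_n -> set R, (forall i, measurable (B i)) ->
    P (\bigcap_i (Y i @^-1` B i)) = (\prod_(i < n) P (Y i @^-1` B i))%E.

(* The time index is [0, +oo[: the values of [X] at negative times are
   arbitrary and never constrained. *)
Record is_levy_process d (T : measurableType d) (R : realType)
    (P : probability T R) (X : R -> {RV P >-> R}) : Prop := IsLevyProcess {
  levy_start : forall w, X 0 w = 0 ;
  levy_stationary : forall s h : R, 0 <= s -> 0 <= h ->
    forall B : set R, measurable B ->
      P ((X (s + h) \- X s) @^-1` B) = P (X h @^-1` B) ;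
  levy_independent : forall (n : nat) (t : nat -> R),
    0 <= t 0%N -> nondecreasing_seq t ->
    mutually_independent P (fun i : 'I_n => X (t i.+1) \- X (t i)) ;
  levy_right_continuous : forall w (t : R), 0 <= t ->
    X ^~ w @ t^'+ --> X t w ;
  levy_left_limit : forall w (t : R), 0 < t -> cvg (X ^~ w @ t^'-) }.

(* For fixed [xi], the values [cexp (- t * psi xi)] for all [t >= 0] determine
   [psi xi]; hence this specifies the function [psi] uniquely. *)
Definition is_char_exponent d (T : measurableType d) (R : realType)
    (P : probability T R) (X : R -> {RV P >-> R}) (psi : R -> R[i]) : Prop :=
  forall t xi : R, 0 <= t ->
    Cexpectation P (fun w => cexp ('i%C * (xi * X t w)%:C))
    = cexp (- t%:C * psi xi).

(* A measure on R \ {0} is encoded as a Borel measure on R not charging 0.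
   The integrability condition makes it finite away from 0, hence Radon on
   R \ {0}. *)
Record is_levy_measure (R : realType)
    (nu : {measure set (measurableTypeR R) -> \bar R}) : Prop :=
  IsLevyMeasure {
  levy_measure0 : nu [set 0] = 0%E ;
  levy_measure_int :
    (\int[nu]_(x in [set~ 0%R]) (Num.min (x ^+ 2) 1)%:E < +oo)%E }.

Definition levy_khintchine (R : realType) (b Q : R)
    (nu : {measure set (measurableTypeR R) -> \bar R}) (xi : R) : R[i] :=
  - ('i%C * (b * xi)%:C) + (2^-1 * Q * xi ^+ 2)%:C
  + Cintegral nu [set~ 0] (fun x : R =>
      1 - cexp ('i%C * (xi * x)%:C)
      + 'i%C * (xi * x * \1_(`]0, 1[ : set R) `|x|)%:C).

Record is_levy_triplet (R : realType) (psi : R -> R[i]) (b Q : R)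
    (nu : {measure set (measurableTypeR R) -> \bar R}) : Prop :=
  IsLevyTriplet {
  levy_triplet_Q : 0 <= Q ;
  levy_triplet_nu : is_levy_measure nu ;
  levy_triplet_psi : forall xi, psi xi = levy_khintchine b Q nu xi }.

(* Support of [nu] in the space R \ {0}: since [nu] does not charge 0, open
   neighbourhoods in R and in R \ {0} give the same points. *)
Definition levy_support (R : realType)
    (nu : {measure set (measurableTypeR R) -> \bar R}) : set R :=
  [set x | x != 0 /\ forall U : set R, open U -> U x -> (0 < nu U)%E].

Definition lattice (R : realType) (c : R) : set R :=
  [set x | exists k : int, x = c * k%:~R].

(* Main.v *)
Require Import Defs.
From HB Require Import structures.
From mathcomp Require Import all_boot all_order all_algebra.
From mathcomp Require Import all_classical all_reals all_analysis.
From mathcomp Require Import measurable_realfun ring lra.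
Import Order.TTheory GRing.Theory Num.Theory.
Import numFieldNormedType.Exports.

Set Implicit Arguments.
Unset Strict Implicit.
Unset Printing Implicit Defensive.

Local Open Scope classical_set_scope.
Local Open Scope ring_scope.
Local Open Scope complex_scope.

(** The lattice [2 pi / beta Z] is the set where [cos (beta x) = 1].  Hence
    [E exp (i beta Y) = exp (i a)] holds exactly when [cos (beta Y - a) = 1]
    almost surely, because [1 - cos] is nonnegative and has zero expectation;
    together with [E exp (i beta X_t) = exp (- t psi beta)] this links the
    modulus of the characteristic function, [Re (psi beta) = 0] and the
    lattice conditions on [X].
    On the other side,
    [Re (psi beta) = Q beta^2 / 2 + int (1 - cos (beta x)) nu(dx)] is a sum of
    nonnegative terms, so it vanishes iff [Q = 0] and [nu] is carried by the
    lattice; then [Im (psi beta)] is [- b beta] plus a finite sum over the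
    lattice points of modulus less than 1. *)

(** * Trigonometry of the lattice $2\pi\beta^{-1}\mathbb{Z}$ *)

Lemma cosD2piz {R : realType} (y : R) (k : int) :
  cos (y + pi *+ 2 * k%:~R) = cos y.
Proof.
have per n z : cos (z + pi *+ 2 * n%:R) = cos z :> R.
  by rewrite mulr_natr; exact: (periodicn (@cosD2pi R)).
case: k => n; first exact: per.
by rewrite -[LHS](per n.+1) NegzE intrN mulrN subrK.
Qed.

(** Removing full periods leaves a remainder [r] in $[0,2\pi)$ with the same cosine. On $[0,\pi]$
    injectivity of cosine forces $r=0$; on $(\pi,2\pi)$ the same argument applied to $2\pi-r$ would
    give $r=2\pi$, which is excluded. *)
Lemma cos_eq1P {R : realType} (y : R) :
  cos y = 1 <-> exists k : int, y = pi *+ 2 * k%:~R.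
Proof.
split=> [cy|[k ->]]; last by rewrite -[_ * _]add0r cosD2piz cos0.
have pi0 : 0 < pi *+ 2 :> R by rewrite mulrn_wgt0 ?pi_gt0.
set k := Num.floor (y / (pi *+ 2)); exists k.
set r := y - pi *+ 2 * k%:~R.
suff r0 : r = 0 by apply/eqP; rewrite -subr_eq0 -/r r0.
have cr : cos r = 1 by rewrite -(cosD2piz r k) subrK.
have /andP[kl kr] := floor_itv (y / (pi *+ 2)).
have rge : 0 <= r by rewrite subr_ge0 mulrC -ler_pdivlMr.
have rlt : r < pi *+ 2.
  by rewrite ltrBlDr -[X in X + _]mulr1 -mulrDr addrC -intrD1 mulrC -ltr_pdivrMr.
have inj0 z : 0 <= z <= pi -> cos z = 1 -> z = 0 :> R.
  by move=> zpi cz; apply: cos_inj; rewrite ?cos0// in_itv/= ?lexx ?pi_ge0.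
have [rpi|pir] := leP r pi; first by apply: inj0 => //; rewrite rge.
have /inj0 : 0 <= pi *+ 2 - r <= pi.
  by rewrite subr_ge0 (ltW rlt) lerBlDr mulr2n lerD2l ltW.
by rewrite -cosN opprB -(cosD2pi (r - _)) subrK => /(_ cr); lra.
Qed.

Lemma normr_sin_le {R : realType} (y : R) : `|sin y| <= `|y|.
Proof.
wlog y0 : y / 0 <= y.
  move=> H; have [/H//|/ltW y0] := leP 0 y.
  by rewrite -normrN -sinN -[leRHS]normrN H// oppr_ge0.
have [|c _] := @MVT_segment R sin cos 0 y y0.
  by apply: continuous_subspaceT; exact: continuous_sin.
rewrite sin0 !subr0 => ->.
by rewrite normrM ler_piMl// cos_max.
Qed.

(** By the half-angle formula, $1-\cos y=2\sin^2(y/2)$, and $|\sin(y/2)|\le|y/2|$. The bound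
    controls $1-\cos$ near 0, where a Lévy measure may have infinite mass. *)
Lemma cos_ge1Bsqr {R : realType} (y : R) : 1 - cos y <= y ^+ 2.
Proof.
have yE : y = (y / 2) *+ 2 by rewrite -mulr_natr divfK.
have : sin (y / 2) ^+ 2 <= (y / 2) ^+ 2.
  by rewrite -[leLHS]real_normK ?num_real// -[leRHS]real_normK ?num_real//
    lerXn2r ?nnegrE// normr_sin_le.
rewrite [X in cos X]yE cos_mulr2n cos2sin2; set s := sin _; have := sqr_ge0 y.
by rewrite expr_div_n; lra.
Qed.

Lemma latticeP {R : realType} (beta x : R) : beta != 0 ->
  lattice (2 * pi * beta^-1) x <-> cos (beta * x) = 1.
Proof.
move=> b0; rewrite cos_eq1P; split=> -[k].
  by move=> ->; exists k; field.
by move=> E; exists k; rewrite -[x](mulKf b0) E; field.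
Qed.

Lemma cexpE {R : realType} (y : R) : cexp ('i%C * y%:C) = cos y +i* sin y.
Proof.
by rewrite /cexp /= !(mul0r, mul1r, mulr0, sub0r, add0r, addr0) oppr0 expR0 mul1r.
Qed.

Lemma finite_int_lt {R : realType} (r : R) : finite_set [set k : int | `|k%:~R : R| < r].
Proof.
pose J := `I_(Num.truncn r).+1.
apply: (@sub_finite_set _ _ ((Posz @` J) `|` (Negz @` J))).
  have nE (n : nat) : (n%:R < r) -> (n < (Num.truncn r).+1)%N.
    by move=> nr; rewrite -(ltr_nat R) (lt_trans nr)// truncnS_gt.
  case=> n /= kr; [left|right]; exists n => //=; apply: nE.
    by rewrite -[n%:R]ger0_norm.
  apply: le_lt_trans kr.
  rewrite NegzE intrN normrN ger0_norm// ler_nat//.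
by rewrite finite_setU; split; apply: finite_image; exact: finite_II.
Qed.

(** * Almost everywhere equality and real-valued integrals *)

Section Rintegral_ae.
Context {d : measure_display} {T : measurableType d} {R : realType}.
Context (mu : {measure set T -> \bar R}) (D : set T) (mD : measurable D).

Lemma ae_eq_Rintegral (f g : T -> R) :
  measurable_fun D f -> measurable_fun D g ->
  {ae mu, forall x, D x -> f x = g x} ->
  \int[mu]_(x in D) f x = \int[mu]_(x in D) g x.
Proof.
move=> mf mg fg; congr fine; apply: ae_eq_integral => //.
- exact/measurable_EFinP.
- exact/measurable_EFinP.
- by apply: filterS fg => x fg /fg ->.
Qed.

Lemma Rintegral_eq0_ae (f : T -> R) : mu.-integrable D (EFin \o f) ->
  (forall x, D x -> 0 <= f x) -> \int[mu]_(x in D) f x = 0 ->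
  {ae mu, forall x, D x -> f x = 0}.
Proof.
move=> intf f0 If0.
have mf : measurable_fun D (EFin \o f) by case/integrableP: intf.
have /(ae_eq_integral_abs mu mD mf) : (\int[mu]_(x in D) `|(EFin \o f) x| = 0)%E.
  under eq_integral => x /set_mem Dx do rewrite gee0_abs ?lee_fin ?f0//.
  by rewrite -[LHS]fineK ?integrable_fin_num// [fine _]If0.
by apply: filterS => x fx Dx; have [] := fx Dx.
Qed.

End Rintegral_ae.

(** * When a characteristic function takes a value of modulus 1 *)

Section unimodular.
Context {d : measure_display} {T : measurableType d} {R : realType}.
Context (P : probability T R).

Lemma integrable_norm_le1 (f : T -> R) : measurable_fun setT f ->
  (forall x, `|f x| <= 1) -> P.-integrable setT (EFin \o f).
Proof.
move=> mf f1; apply: measurable_bounded_integrable => //.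
  by rewrite -ge0_fin_numE// fin_num_measure.
by exists 1; split=> // M M1 x _ /=; rewrite (le_trans (f1 x))// ltW.
Qed.

Context (Y : T -> R) (mY : measurable_fun setT Y).

Lemma measurable_cos_comp : measurable_fun setT (fun w => cos (Y w)).
Proof.
by apply: measurableT_comp => //; apply: continuous_measurable_fun; exact: continuous_cos.
Qed.

Lemma measurable_sin_comp : measurable_fun setT (fun w => sin (Y w)).
Proof.
by apply: measurableT_comp => //; apply: continuous_measurable_fun; exact: continuous_sin.
Qed.

Lemma Cexpectation_cexpE : Cexpectation P (fun w => cexp ('i%C * (Y w)%:C)) =
  (\int[P]_w cos (Y w)) +i* (\int[P]_w sin (Y w)).
Proof.
by congr (_ +i* _); apply: eq_Rintegral => w _; rewrite cexpE.
Qed.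

(** Integrating $\cos(Y-a)=\cos Y\cos a+\sin Y\sin a$ turns the left side into
    $\mathbb{E}\cos(Y-a)=\cos^2a+\sin^2a=1$, so the nonnegative $1-\cos(Y-a)$ has integral 0.
    Conversely, $\cos(Y-a)=1$ forces $\sin(Y-a)=0$, so that $\cos Y=\cos a$ and $\sin Y=\sin a$
    almost surely. *)
Lemma Cexpectation_cexp_eqP (a : R) :
  Cexpectation P (fun w => cexp ('i%C * (Y w)%:C)) = cexp ('i%C * a%:C) <->
  {ae P, forall w, cos (Y w - a) = 1}.
Proof.
have mcos := measurable_cos_comp; have msin := measurable_sin_comp.
have icos : P.-integrable setT (EFin \o (fun w => cos (Y w))).
  by apply: integrable_norm_le1 => // x; exact: cos_max.
have isin : P.-integrable setT (EFin \o (fun w => sin (Y w))).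
  by apply: integrable_norm_le1 => // x; exact: sin_max.
rewrite Cexpectation_cexpE cexpE; split=> [[Ic Is]|ae1].
  have mB : measurable_fun setT (fun w => cos (Y w - a)).
    under eq_fun do rewrite cosB.
    by apply: measurable_funD; apply: measurable_funM.
  have iB : P.-integrable setT (EFin \o (fun w => cos (Y w - a))).
    by apply: integrable_norm_le1 => // x; exact: cos_max.
  have i1 : P.-integrable setT (EFin \o (fun=> 1 : R)).
    by apply: integrable_norm_le1 => // x; rewrite normr1.
  have int0 : \int[P]_w (1 - cos (Y w - a)) = 0.
    rewrite RintegralB// Rintegral_cst//= probability_setT mulr1.
    under eq_Rintegral do rewrite cosB.
    rewrite RintegralD//; last 2 first.
    - exact: (@integrableZr _ _ _ P setT measurableT _ _ icos).
    - exact: (@integrableZr _ _ _ P setT measurableT _ _ isin).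
    by rewrite !RintegralZr// Ic Is -!expr2 cos2Dsin2 subrr.
  have ge0 w : setT w -> 0 <= 1 - cos (Y w - a) by rewrite subr_ge0 cos_le1.
  have iD : P.-integrable setT (EFin \o (fun w => 1 - cos (Y w - a))).
    exact: (integrableB measurableT i1 iB).
  apply: filterS (Rintegral_eq0_ae measurableT iD ge0 int0) => w /(_ I)/eqP.
  by rewrite subr_eq0 => /eqP.
have YE w : Y w = (Y w - a) + a by rewrite subrK.
congr (_ +i* _).
- rewrite (@ae_eq_Rintegral _ _ _ P setT measurableT _ (cst (cos a)))//.
    by rewrite Rintegral_cst//= probability_setT mulr1.
  apply: filterS ae1 => w c1 _; rewrite YE cosD c1 cos1sin0 ?c1 ?normr1//.
  by rewrite mul0r subr0 mul1r.
- rewrite (@ae_eq_Rintegral _ _ _ P setT measurableT _ (cst (sin a)))//.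
    by rewrite Rintegral_cst//= probability_setT mulr1.
  apply: filterS ae1 => w c1 _; rewrite YE sinD c1 cos1sin0 ?c1 ?normr1//.
  by rewrite mul0r add0r mul1r.
Qed.

End unimodular.

(** * Lévy measures: support, integrability and atoms *)

Section levy_measure.
Context {R : realType} (nu : {measure set (measurableTypeR R) -> \bar R}).

(** A Lindelöf argument: each point outside [A] has a null open neighbourhood, and countably many of
    these suffice. Since [levy_support] omits 0 by definition, [A 0] ensures that a point outside
    [A] is nonzero, so that its absence from the support does yield such a neighbourhood. *)
Lemma levy_support_subsetP (A : set R) : closed A -> A 0 ->
  levy_support nu `<=` A <-> nu (~` A) = 0%E.
Proof.
move=> /closed_openC oA A0.
have mA : measurable (~` A) by exact: open_measurable.
split=> [sA|nA x [x0 xU]]; last first.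
  by apply/not_notP => nAx; have := xU _ oA nAx; rewrite nA ltxx.
(* Balls with rational centre and radius: a countable cover by null sets. *)
pose B (q : rat * rat) : set R := ball (ratr q.1 : R) (ratr q.2).
(* [F q] is the ball if that ball is null and empty otherwise, so the family is null for every pair
   of rationals. *)
pose F (q : rat * rat) := [set y : R | B q y /\ nu (B q) = 0%E].
have mF q : measurable (F q : set (measurableTypeR R)).
  have [q0|q0] := pselect (nu (B q) = 0%E).
    rewrite (_ : F q = B q).
      by apply: open_measurable; exact: ball_open.
    by apply/seteqP; split=> [y []|y].
  by rewrite (_ : F q = set0)// -subset0 => y [].
have F0 q : nu.-negligible (F q).
  exists (F q); split=> //.
  have [q0|q0] := pselect (nu (B q) = 0%E).
    by rewrite -q0; congr (nu _); apply/seteqP; split=> [y []|y].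
  by rewrite (_ : F q = set0) ?measure0// -subset0 => y [].
apply/negligibleP => //.
(* The pairs are enumerated by their integer codes; a number that codes no pair contributes
   [set0]. *)
apply: (@negligibleS _ _ _ nu (\bigcup_n oapp F set0 (unpickle n))); last first.
  apply: negligible_bigcup => n.
  by case: (unpickle n) => [q|] /=; [exact: F0|exact: negligible_set0].
move=> x nAx.
have [U [oU Ux U0]] : exists U : set R, [/\ open U, U x & nu U = 0%E].
  apply: contrapT => nU; apply: (nAx); apply: sA; split.
    by apply/eqP => x0; apply: nAx; rewrite x0.
  move=> U oU Ux; rewrite lt0e measure_ge0 andbT; apply/eqP => U0.
  by apply: nU; exists U.
have [c [r [xB BU]]] := open_subball_rat oU (mem_set Ux).
suff xF : oapp F set0 (unpickle (pickle (c, r))) x by exists (pickle (c, r)); [exact: I|].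
rewrite pickleK; split; first exact: set_mem.
have mU : measurable (U : set (measurableTypeR R)) by exact: open_measurable.
have mB : measurable (B (c, r) : set (measurableTypeR R)).
  by apply: open_measurable; exact: ball_open.
exact: (subset_measure0 mB mU BU U0).
Qed.

Context (hnu : is_levy_measure nu).

Let mD : measurable ([set~ 0] : set (measurableTypeR R)).
Proof. exact: measurableC. Qed.

Lemma measurable_min_sqr (D : set (measurableTypeR R)) :
  measurable_fun D (fun x : R => (Num.min (x ^+ 2) 1)%:E).
Proof.
by apply/measurable_EFinP; apply: measurable_minr => //; exact: measurable_funX.
Qed.

Lemma integrable_min_sqr :
  nu.-integrable [set~ 0] (fun x : R => (Num.min (x ^+ 2) 1)%:E).
Proof.
apply/integrableP; split; first exact: measurable_min_sqr.
under eq_integral do rewrite gee0_abs ?lee_fin ?le_min ?sqr_ge0 ?ler01//.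
exact: levy_measure_int hnu.
Qed.

(** On the atom the integrand $\min(x^2,1)$ is a positive constant, and its integral there is at
    most the finite total. Hence [fine] loses nothing when applied to the masses in the drift
    formula. *)
Lemma levy_measure_set1 (a : R) : a != 0 -> (nu [set a] < +oo)%E.
Proof.
move=> a0; have m0 : 0 < Num.min (a ^+ 2) 1 by rewrite lt_min ltr01 andbT exprn_even_gt0.
have : ((Num.min (a ^+ 2) 1)%:E * nu [set a] < +oo)%E.
  apply: le_lt_trans (levy_measure_int hnu).
  have ma : measurable ([set a] : set (measurableTypeR R)) by exact: measurable_set1.
  rewrite -integral_cst//.
  rewrite (@eq_integral _ _ _ nu _ (fun x : R => (Num.min (x ^+ 2) 1)%:E)); last first.
    by move=> x /set_mem ->.
  apply: ge0_subset_integral => //.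
  - exact: measurable_min_sqr.
  - by move=> x _; rewrite lee_fin le_min sqr_ge0 ler01.
  - by move=> x -> /eqP; rewrite (negbTE a0).
by case: (nu [set a]) => [r||]//; rewrite ?ltry// mulry gtr0_sg// mul1e.
Qed.

(** * Real and imaginary parts of the exponent at [beta] *)

Context (beta : R).

(** Domination by $(2+\beta^2)\min(x^2,1)$: the term $\beta^2$ serves the bound $1-\cos(\beta
    x)\le\beta^2x^2$, the term 2 the bound $1-\cos(\beta x)\le2$. *)
Lemma integrable_1Bcos :
  nu.-integrable [set~ 0] (EFin \o (fun x : R => 1 - cos (beta * x))).
Proof.
have := integrableZl mD (2 + beta ^+ 2) integrable_min_sqr.
apply: le_integrable => //.
  apply/measurable_EFinP; apply: measurable_funB => //.
  by apply: measurable_funTS; apply: measurable_cos_comp; exact: measurable_funM.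
move=> x _ /=; rewrite lee_fin !ger0_norm ?subr_ge0 ?cos_le1//; last first.
  by rewrite mulr_ge0// ?addr_ge0 ?sqr_ge0// le_min sqr_ge0 ler01.
rewrite minr_pMr ?addr_ge0 ?sqr_ge0// le_min; apply/andP; split.
  rewrite (le_trans (cos_ge1Bsqr _))// exprMn ler_wpM2r ?sqr_ge0//.
  by rewrite lerDr.
by have := cos_geN1 (beta * x); have := sqr_ge0 beta; lra.
Qed.

Lemma levy_khintchineE (b Q : R) : levy_khintchine b Q nu beta =
  (2^-1 * Q * beta ^+ 2 + \int[nu]_(x in [set~ 0]) (1 - cos (beta * x))) +i*
  (\int[nu]_(x in [set~ 0])
     (beta * x * \1_(`]0, 1[ : set R) `|x| - sin (beta * x)) - b * beta).
Proof.
rewrite /levy_khintchine.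
set I1 := Rintegral _ _ _; set I2 := Rintegral _ _ _.
have -> : Cintegral nu [set~ 0] (fun x : R => 1 - cexp ('i%C * (beta * x)%:C) +
    'i%C * (beta * x * \1_(`]0, 1[ : set R) `|x|)%:C) = I1 +i* I2.
  congr (_ +i* _); apply: eq_Rintegral => x _; rewrite cexpE /=; first by ring.
  by ring.
by apply/eqP; rewrite eq_complex /=; apply/andP; split; apply/eqP; ring.
Qed.

Context (beta0 : beta != 0).

Let c := 2 * pi * beta^-1.
Let K := [set k : int | k != 0 /\ `|k%:~R : R| < `|beta| / (2 * pi)].

(** A sum [\sum_(k \in K)] defaults to 0 when infinitely many of its terms are nonzero; finiteness
    makes it a genuine finite sum. *)
Let finK : finite_set K.
Proof. by apply: sub_finite_set (finite_int_lt (`|beta| / (2 * pi))) => k -[]. Qed.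

Let c0 : c != 0.
Proof. by apply: mulf_neq0; [rewrite gt_eqF// mulr_gt0 ?pi_gt0|rewrite invr_eq0]. Qed.

Let betac : beta * c = 2 * pi.
Proof. by rewrite /c; field. Qed.

(** As $|c|=2\pi/|\beta|$, the cut-off of the compensator at modulus 1 becomes the bound on $k$ in
    [K]. *)
Lemma small_lattice_point (k : int) :
  (`|c * k%:~R| < 1) = (`|k%:~R : R| < `|beta| / (2 * pi)).
Proof.
have pi2_ge0 : 0 <= 2 * pi :> R by rewrite mulr_ge0 ?pi_ge0.
have -> : `|beta| / (2 * pi) = `|c|^-1.
  by rewrite -[2 * pi]ger0_norm// -betac normrM invfM mulrA divff ?normr_eq0// mul1r.
by rewrite normrM mulrC -ltr_pdivlMr ?normr_gt0// div1r.
Qed.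

(** On the lattice the sine vanishes and $x=cm$ with $m\neq0$. What remains is $\beta x=2\pi m$ if
    $|x|<1$ and 0 otherwise, and only the indicator with $k=m$ can be nonzero at $x$. *)
Lemma compensated_sin_lattice (x : R) : x != 0 -> cos (beta * x) = 1 ->
  beta * x * \1_(`]0, 1[ : set R) `|x| - sin (beta * x) =
  \sum_(k \in K) 2 * pi * k%:~R * (\1_[set c * k%:~R] x : R).
Proof.
move=> x0 cx; rewrite cos1sin0 ?cx ?normr1// subr0.
have [m xE] := (latticeP _ beta0).2 cx; rewrite -/c in xE.
have m0 : m != 0 by apply: contraNneq x0 => m0; rewrite xE m0 mulr0.
have off k : k != m -> 2 * pi * k%:~R * (\1_[set c * k%:~R] x : R) = 0.
  move=> km; rewrite indicE memNset ?mulr0//= xE => /(mulfI c0)/eqP.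
  by rewrite eqr_int eq_sym (negbTE km).
rewrite indicE mem_setE in_itv/= normr_gt0 x0/=.
have -> : (`|x| < 1) = (`|m%:~R : R| < `|beta| / (2 * pi)).
  by rewrite xE small_lattice_point.
have [mK|mK] := pselect (K m).
  rewrite (fsbigD1 m)//=.
  rewrite fsbig1 ?addr0; last by move=> k [_ /eqP]; exact: off.
  rewrite mK.2 indicE mem_set/=; last by rewrite xE.
  by rewrite xE mulrA betac.
have -> : (`|m%:~R : R| < `|beta| / (2 * pi)) = false.
  by apply/negbTE/negP => mb; apply: mK.
rewrite mulr0 fsbig1// => k kK; apply: off.
by apply: contra_not_neq mK => <-.
Qed.

Lemma closed_cos_eq1 : closed [set x : R | cos (beta * x) = 1].
Proof.
apply: (@closed_comp _ _ (fun x : R => cos (beta * x)) [set 1]); last exact: closed_eq.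
move=> x _; apply: continuous_comp; last exact: continuous_cos.
by apply: continuousM; [exact: cvg_cst|exact: cvg_id].
Qed.

Lemma measurable_compensated_sin : measurable_fun ([set~ 0] : set (measurableTypeR R))
  (fun x : R => beta * x * \1_(`]0, 1[ : set R) `|x| - sin (beta * x)).
Proof.
apply: measurable_funTS; apply: measurable_funB.
  apply: measurable_funM; first exact: measurable_funM.
  apply: measurableT_comp; last exact: normr_measurable.
  by apply: measurable_indic; exact: measurable_itv.
by apply: measurable_sin_comp; exact: measurable_funM.
Qed.

(** The lattice carries [nu], so the integrand may be replaced by the finite sum of indicators;
    integrating term by term produces the masses of the lattice points. *)
Lemma Rintegral_compensated_sin : nu (~` [set x | cos (beta * x) = 1]) = 0%E ->
  \int[nu]_(x in [set~ 0]) (beta * x * \1_(`]0, 1[ : set R) `|x| - sin (beta * x)) =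
  2 * pi * \sum_(k \in K) (k%:~R * fine (nu [set c * k%:~R])).
Proof.
move=> nuN.
have m1 (a : R) : measurable ([set a] : set (measurableTypeR R)).
  exact: measurable_set1.
have nu1 (a : R) : nu [set a] \is a fin_num.
  rewrite ge0_fin_numE//; have [->|] := eqVneq a 0; last exact: levy_measure_set1.
  by rewrite (levy_measure0 hnu).
have fm (k : int) : measurable_fun ([set~ 0] : set (measurableTypeR R))
    (fun x : R => (\1_[set c * k%:~R] x : R)).
  by apply: measurable_funTS; exact: measurable_indic.
have fint (k : int) : (\int[nu]_(x in [set~ 0%R]) (\1_[set (c * k%:~R)%R] x)%:E =
    nu ([set c * k%:~R]%R `&` [set~ 0%R]))%E.
  by rewrite integral_indic.
have int1 (k : int) : nu.-integrable [set~ 0]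
    (fun x : R => (\1_[set c * k%:~R] x : R)%:E).
  apply/integrableP; split; first exact/measurable_EFinP.
  under eq_integral do rewrite gee0_abs ?lee_fin//.
  rewrite fint; apply: (@le_lt_trans _ _ (nu [set c * k%:~R])).
    by apply: le_measure; rewrite ?inE//; exact: measurableI.
  by rewrite ltey_eq nu1.
rewrite (@ae_eq_Rintegral _ _ _ nu _ mD _
  (fun x => \sum_(k \in K) 2 * pi * k%:~R * (\1_[set c * k%:~R] x : R))); first last.
- exists (~` [set x | cos (beta * x) = 1]); split=> //.
    by apply: open_measurable; exact: closed_openC closed_cos_eq1.
  move=> x /= nx cx; apply: nx => x0; apply: compensated_sin_lattice => //; exact/eqP.
- under eq_fun do rewrite fsbig_finite//.
  by apply: measurable_sum => k; apply: measurable_funM.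
- exact: measurable_compensated_sin.
rewrite /Rintegral.
under eq_integral do rewrite fsbig_finite//= -sumEFin.
rewrite integral_sum//; last first.
  by move=> k; under eq_fun do rewrite EFinM; exact: integrableZl.
rewrite fsbig_finite//= big_distrr/=.
rewrite (eq_bigr (fun k => (2 * pi * (k%:~R * fine (nu [set c * k%:~R])))%:E)).
  by rewrite sumEFin.
move=> k _; under eq_integral do rewrite EFinM.
rewrite integralZl// fint mulrA [RHS]EFinM fineK//.
(* The domain omits 0, so the singleton survives the intersection only for $k\neq0$; at $k=0$ both
   sides carry the factor 0. *)
have [->|k0] := eqVneq k 0; first by rewrite mulr0z mulr0 !mul0e.
rewrite setIidl// => x -> /eqP.
by rewrite mulf_eq0 (negbTE c0) intr_eq0 (negbTE k0).
Qed.

Lemma levy_support_latticeP :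
  levy_support nu `<=` lattice c <-> nu (~` [set x | cos (beta * x) = 1]) = 0%E.
Proof.
have -> : lattice c = [set x | cos (beta * x) = 1].
  by apply/seteqP; split=> x /(latticeP x beta0).
apply: levy_support_subsetP; first exact: closed_cos_eq1.
by rewrite /= mulr0 cos0.
Qed.

Lemma Re_levy_khintchine_eq0P (b Q : R) : 0 <= Q ->
  complex.Re (levy_khintchine b Q nu beta) = 0 <->
  Q = 0 /\ levy_support nu `<=` lattice c.
Proof.
move=> Q0; rewrite levy_support_latticeP levy_khintchineE /=.
have ge0 (x : R) : [set~ 0] x -> 0 <= 1 - cos (beta * x) by rewrite subr_ge0 cos_le1.
have q0 : 0 <= 2^-1 * Q * beta ^+ 2.
  by apply: mulr_ge0; [exact: mulr_ge0|exact: sqr_ge0].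
split=> [/eqP|[-> nuN]].
  rewrite paddr_eq0//; last exact: Rintegral_ge0.
  rewrite !mulf_eq0 invr_eq0 pnatr_eq0 orbb (negbTE beta0) !orbF/= => /andP[/eqP-> /eqP I0].
  split=> //.
  have mN : measurable (~` [set x | cos (beta * x) = 1] : set (measurableTypeR R)).
    by apply: open_measurable; exact: closed_openC closed_cos_eq1.
  apply/(negligibleP _ mN).
  (* Points off the lattice lie in the exceptional set of the almost everywhere statement: they are
     nonzero because $\cos0=1$. *)
  apply: negligibleS (Rintegral_eq0_ae mD integrable_1Bcos ge0 I0) => x /= cx H.
  apply: cx; have [->|/eqP x0] := eqVneq x 0; first by rewrite mulr0 cos0.
  by have /eqP := H x0; rewrite subr_eq0 => /eqP.
rewrite mulr0 mul0r add0r.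
rewrite (@ae_eq_Rintegral _ _ _ nu _ mD _ (cst 0))//.
- by rewrite /Rintegral integral0_eq.
- by apply/measurable_EFinP; case/integrableP: integrable_1Bcos.
- exists (~` [set x | cos (beta * x) = 1]); split=> //.
    by apply: open_measurable; exact: closed_openC closed_cos_eq1.
  by move=> x /= nx cx; apply: nx => _; rewrite cx subrr.
Qed.

End levy_measure.

(** * Complex exponentials and the equivalences *)

Lemma normc_cexp {R : realType} (z : R[i]) : `|cexp z| = (expR (complex.Re z))%:C.
Proof.
rewrite /cexp normrM !normc_def /= expr0n addr0 cos2Dsin2 sqrtr1 mulr1.
by rewrite sqrtr_sqr ger0_norm ?expR_ge0.
Qed.

(** All times together remove the $2\pi i$ ambiguity of the logarithm. Moduli at $t=1$ identify the
    real parts. Then $\cos(t(b-b'))=1$ for every $t>0$, whereas $t=\pi/|b-b'|$ would give $-1$ if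
    $b\neq b'$. *)
Lemma cexp_scale_inj {R : realType} (z w : R[i]) :
  (forall t : R, 0 < t -> cexp (t%:C * z) = cexp (t%:C * w)) -> z = w.
Proof.
case: z w => [a b] [a' b'] H.
have scaleE t x y : t%:C * (x +i* y) = (t * x) +i* (t * y) :> R[i].
  by apply/eqP; rewrite eq_complex /= !mul0r subr0 addr0 !eqxx.
have aE : a = a'.
  have := congr1 (fun u => `|u|) (H 1 ltr01).
  by rewrite !normc_cexp !scaleE /= !mul1r => /complexI /expR_inj.
congr (_ +i* _) => //; rewrite -{a'}aE in H.
have cos1 t : 0 < t -> cos (t * (b - b')) = 1.
  move=> /H; rewrite !scaleE /cexp /= => csE.
  have expC0 : (expR (t * a))%:C != 0 by rewrite eq_complex /= gt_eqF ?expR_gt0.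
  have [cE sE] := mulfI expC0 csE.
  by rewrite mulrBr cosB cE sE -!expr2 cos2Dsin2.
apply/eqP; rewrite -subr_eq0; apply/negPn/negP => v0.
have := cos1 (pi / `|b - b'|); rewrite divr_gt0 ?pi_gt0 ?normr_gt0// => /(_ isT).
rewrite -cos_norm normrM ger0_norm ?divr_ge0 ?pi_ge0// divfK ?normr_eq0// cospi.
lra.
Qed.

Theorem theorem14 (d : measure_display) (T : measurableType d) (R : realType)
    (P : probability T R) (X : R -> {RV P >-> R}) (psi : R -> R[i])
    (b Q : R) (nu : {measure set (measurableTypeR R) -> \bar R}) (beta : R)
    (hX : is_levy_process X) (hpsi : is_char_exponent X psi)
    (htriplet : is_levy_triplet psi b Q nu) (hbeta : beta != 0) :
  let cf (t : R) : R[i] :=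
    Cexpectation P (fun w => cexp ('i%C * (beta * X t w)%:C)) in
  let L : set R := lattice (2 * pi * beta^-1) in
  let A (alpha : R) : Prop := psi beta = 'i%C * alpha%:C in
  let D (alpha : R) : Prop :=
    forall t : R, 0 < t -> {ae P, forall w, L (X t w + alpha * beta^-1 * t)} in
  let E (alpha : R) : Prop :=
    [/\ levy_support nu `<=` L,
        Q = 0
      & b = - alpha * beta^-1
            + 2 * pi * beta^-1
              * \sum_(k \in [set k : int |
                    k != 0 /\ `|k%:~R : R| < `|beta| / (2 * pi)])
                  (k%:~R * fine (nu [set 2 * pi * beta^-1 * k%:~R]))] in
  [<-> (exists alpha : R, A alpha);
       (exists t : R, 0 < t /\ `|cf t| = 1);
       (forall t : R, 0 < t -> `|cf t| = 1);
       (exists t0 gamma : R, 0 < t0 /\ {ae P, forall w, L (X t0 w + gamma)});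
       (exists alpha : R, D alpha);
       (exists alpha : R, E alpha)]
  /\ (forall alpha : R, [<-> A alpha; D alpha; E alpha]).
Proof.
move=> cf L A D E.
have [Q0 hnu hLK] := htriplet.
have cfE t : 0 <= t -> cf t = cexp (t%:C * - psi beta).
  by move=> t0; rewrite mulrN -mulNr; exact: hpsi.
have mY t : measurable_fun setT (fun w => beta * X t w) by exact: measurable_funM.
have latE t g w : L (X t w + g) <-> cos (beta * X t w - - (beta * g)) = 1.
  by rewrite opprK -mulrDr; exact: latticeP.
(* The shifted variable lies in the lattice iff $\beta X_t$ is congruent to $-\beta g$ modulo
   $2\pi$, which prescribes the value of the characteristic function. *)
have cf_latticeP t g : cf t = cexp ('i%C * (- (beta * g))%:C) <->
    {ae P, forall w, L (X t w + g)}.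
  rewrite (Cexpectation_cexp_eqP P (mY t)).
  by split; apply: filterS => w /latE.
(* For the shift $g=\alpha\beta^{-1}t$ of (d) the exponent $-i\beta g$ is $-t\cdot i\alpha$, linear
   in $t$ like $-t\psi(\beta)$. *)
have driftE t alpha : 'i%C * (- (beta * (alpha * beta^-1 * t)))%:C =
    t%:C * - ('i%C * alpha%:C) :> R[i].
  by apply/eqP; rewrite eq_complex /=; apply/andP; split; apply/eqP; field.
have AD alpha : A alpha <-> D alpha.
  split=> [Aa t t0|Da].
    by apply/cf_latticeP; rewrite cfE ?ltW// Aa driftE.
  apply: oppr_inj; apply: cexp_scale_inj => t t0.
  by rewrite -cfE ?ltW// -driftE; apply/cf_latticeP; exact: Da.
have ReA alpha : A alpha -> complex.Re (psi beta) = 0.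
  by move=> ->; rewrite /= mul0r mul1r subr0.
have AE alpha : A alpha <-> E alpha.
  (* With [S] the lattice sum, the imaginary part is $2\pi S-b\beta$; the drift formula is $2\pi
     S-b\beta=\alpha$ solved for $b$. *)
  have ImE : nu (~` [set x | cos (beta * x) = 1]) = 0%E ->
      complex.Im (psi beta) = alpha <-> b = - alpha * beta^-1
            + 2 * pi * beta^-1
              * \sum_(k \in [set k : int |
                    k != 0 /\ `|k%:~R : R| < `|beta| / (2 * pi)])
                  (k%:~R * fine (nu [set 2 * pi * beta^-1 * k%:~R])).
    move=> nuN; rewrite hLK levy_khintchineE /= Rintegral_compensated_sin//.
    set S := \sum_(_ \in _) _.
    by split=> [<-|->]; field.
  have ReE : complex.Re (psi beta) = 0 <-> Q = 0 /\ levy_support nu `<=` L.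
    by rewrite hLK; exact: Re_levy_khintchine_eq0P.
  split=> [Aa|[sL q0 bE]].
    have [q0 sL] := ReE.1 (ReA _ Aa); split=> //.
    apply/ImE; first exact/(levy_support_latticeP nu hbeta).
    by rewrite Aa /=; ring.
  have /levy_support_latticeP nuN := sL.
  apply/eqP; rewrite eq_complex; apply/andP; split; apply/eqP.
    by rewrite ReE.2//=; ring.
  by rewrite ((ImE (nuN hbeta)).2 bE)/=; ring.
have norm_cf t : 0 <= t -> `|cf t| = (expR (t * - complex.Re (psi beta)))%:C.
  by move=> t0; rewrite cfE// normc_cexp; congr (expR _)%:C; case: (psi beta) => x y/=; ring.
have A_b alpha : A alpha -> forall t, 0 < t -> `|cf t| = 1.
  by move=> Aa t t0; rewrite norm_cf ?ltW// (ReA _ Aa) oppr0 mulr0 expR0.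
(* Here $|\mathbb{E}e^{i\beta X_t}|=e^{-t\operatorname{Re}\psi(\beta)}$, so one positive time
   already forces the real part to vanish. *)
have b_A t : 0 < t -> `|cf t| = 1 -> exists alpha, A alpha.
  move=> t0; rewrite norm_cf ?ltW// => /complexI.
  rewrite -expR0 => /expR_inj/eqP; rewrite mulf_eq0 gt_eqF//= oppr_eq0 => /eqP Re0.
  exists (complex.Im (psi beta)); apply/eqP; rewrite eq_complex Re0 /=.
  by apply/andP; split; apply/eqP; ring.
have c_b t g : {ae P, forall w, L (X t w + g)} -> `|cf t| = 1.
  by move=> /cf_latticeP ->; rewrite normc_cexp /= !mul0r mul1r subr0 expR0.
split; last first.
  by move=> alpha; tfae; [move/AD|move/AD/AE|move/AE].
tfae.
- by move=> [alpha /A_b Ab]; exists 1; split => //; exact: Ab.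
- by move=> [t [t0 /(b_A _ t0)[alpha Aa]]]; exact: A_b Aa.
- move=> /(_ 1 ltr01)/(b_A _ ltr01)[alpha /AD Da].
  by exists 1, (alpha * beta^-1 * 1); split=> //; exact: Da.
(* The number $\alpha$ is read off from $\psi(\beta)$ and not from $\gamma$, since the single time
   $t_0$ determines it only modulo $2\pi/t_0$. *)
- move=> [t [g [t0 /c_b/(b_A _ t0)[alpha /AD Da]]]].
  by exists alpha.
- by move=> [alpha /AD/AE Ea]; exists alpha.
- by move=> [alpha /AE Aa]; exists alpha.
Qed.
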